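(* Let $k\ge 1$, and let $\mathbf X=(X_n)_{n\in\mathbb N}$ and $\widetilde{\mathbf X}=(\widetilde X_n)_{n\in\mathbb N}$ be two Markov chains on $E_k=\{0,\dots,k\}$, both having initial measure concentrated at $0$, with transition matrices $P$ and $\widetilde P$ respectively. Let $k$ be an absorbing state for both matrices. If $\widetilde P^{\,n}\unlhd P^{\,n}$ for all $n$ large enough, then $$T_k\preceq_{a.st.}\widetilde T_k .$$
   Context: For probability distributions $\mu,\nu$ on $\{0,\dots,k\}$, $\mu\preceq_{st}\nu$ means $\sum_{l=j}^k\mu_l\le\sum_{l=j}^k\nu_l$ for every $j=0,\dots,k$. For stochastic matrices $A=(a_{i,j})_{i,j=0,\dots,k}$ and $A'=(a'_{i,j})_{i,j=0,\dots,k}$, write $A'\unlhd A$ if and only if $a'_{i,\cdot}\preceq_{st}a_{j,\cdot}$ for all $0\le i\le j\le k$, where $a_{j,\cdot}$ denotes the $j$-th row of $A$ and $a'_{i,\cdot}$ the $i$-th row of $A'$. $T_k=\inf\{n\in\mathbb N:X_n\ge k\}$ and $\widetilde T_k=\inf\{n\in\mathbb N:\widetilde X_n\ge k\}$, with $\mathbb N=\{0,1,2,\dots\}$ and $\inf\emptyset=+\infty$. Asymptotic stochastic order: for (possibly $+\infty$-valued) random variables $X,Y$, $X\preceq_{a.st.}Y$ means that there exists $t_0\in\mathbb R$ such that $\mathbb P(X>t)\le \mathbb P(Y>t)$ for every $t\ge t_0$. *)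

(* Defs.v *)
From HB Require Import structures.
From mathcomp Require Import all_boot all_order all_algebra.
From mathcomp Require Import all_classical all_reals all_analysis.

Set Implicit Arguments.
Unset Strict Implicit.
Unset Printing Implicit Defensive.

Import Order.TTheory GRing.Theory Num.Theory.
Import numFieldNormedType.Exports.

Local Open Scope classical_set_scope.
Local Open Scope ring_scope.

(* The finite state space {0, ..., k} is 'I_k.+1 with its discrete
   sigma-algebra, so that {RV Pr >-> 'I_k.+1} makes sense. *)
HB.instance Definition _ (k : nat) := isPointed.Build 'I_k.+1 ord0.
HB.instance Definition _ (k : nat) := @isMeasurable.Build
  default_measure_display 'I_k.+1 (@discrete_measurable 'I_k.+1)
  (@discrete_measurable0 _) (@discrete_measurableC _)
  (@discrete_measurableU _).

Definition stochastic_mx (R : realType) (k : nat) (A : 'M[R]_k.+1) : Prop :=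
  (forall i j, 0 <= A i j) /\ (forall i, \sum_(j < k.+1) A i j = 1).

Definition absorbing (R : realType) (k : nat) (A : 'M[R]_k.+1)
    (i : 'I_k.+1) : Prop :=
  A i i = 1.

Definition le_st (R : realType) (k : nat) (mu nu : 'rV[R]_k.+1) : Prop :=
  forall j : 'I_k.+1,
    \sum_(l < k.+1 | (j <= l)%N) mu 0 l <= \sum_(l < k.+1 | (j <= l)%N) nu 0 l.

Definition unlhd_mx (R : realType) (k : nat) (A' A : 'M[R]_k.+1) : Prop :=
  forall i j : 'I_k.+1, (i <= j)%N -> le_st (row i A') (row j A).

Definition cond_prob (d : measure_display) (T : measurableType d)
    (R : realType) (Pr : probability T R) (A B : set T) : R :=
  fine (Pr (A `&` B)) / fine (Pr B).

(* Time-homogeneous chain; only the values x 0, ..., x n of x matter. *)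
Definition markov_chain (d : measure_display) (T : measurableType d)
    (R : realType) (Pr : probability T R) (k : nat)
    (X : nat -> {RV Pr >-> 'I_k.+1}) (A : 'M[R]_k.+1) : Prop :=
  forall (n : nat) (x : nat -> 'I_k.+1) (j : 'I_k.+1),
    let past := [set w | forall m : nat, (m <= n)%N -> X m w = x m] in
    Pr past != 0%E ->
    cond_prob Pr [set w | X n.+1 w = j] past = A (x n) j.

(* An infimum in \bar R, hence +oo when the level is never reached. *)
Definition hitting_time (R : realType) (T : Type) (k : nat)
    (X : nat -> T -> 'I_k.+1) (level : nat) : T -> \bar R :=
  fun w => ereal_inf [set n%:R%:E | n in [set n : nat | (level <= X n w)%N]].

(* The two variables may live on different probability spaces. *)
Definition le_ast (R : realType)
    (d : measure_display) (T : measurableType d) (Pr : probability T R)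
    (d' : measure_display) (T' : measurableType d') (Pr' : probability T' R)
    (X : T -> \bar R) (Y : T' -> \bar R) : Prop :=
  exists t0 : R, forall t : R, t0 <= t ->
    (Pr [set w | (t%:E < X w)%E] <= Pr' [set w | (t%:E < Y w)%E])%E.

(* Main.v *)
Require Import Defs.
From mathcomp Require Import all_boot all_order all_algebra.
From mathcomp Require Import all_classical all_reals all_analysis.

Import Order.TTheory GRing.Theory Num.Theory.
Import numFieldNormedType.Exports.

Local Open Scope classical_set_scope.
Local Open Scope ring_scope.

(** Since the state [k] is absorbing, the events [T_k > n] and [X_n <> k]
    coincide up to a null set, so that [P(T_k > t) = 1 - P^n(0, k)] where [n] is
    the integer part of [t].  For large [n], the hypothesis applied to the rows
    [i = j = 0] and to the upper set [{k}] gives [Pt^n(0, k) <= P^n(0, k)]. *)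

(** Law of total probability over the fibres of [Y]. The codomain is an arbitrary finite type
    because it is used both with single states and with whole finite trajectories. *)
Lemma prob_partition_fintype {d : measure_display} {T : measurableType d}
    {R : realType} (Pr : probability T R) {F : finType} (Y : T -> F)
    {E : set T} :
  measurable E -> (forall f, measurable [set w | Y w = f]) ->
  Pr E = (\sum_(f : F) Pr (E `&` [set w | Y w = f]))%E.
Proof.
move=> mE mY.
have EU : E = \bigcup_(f in [set` index_enum F]) (E `&` [set w | Y w = f]).
  apply/seteqP; split => [w Ew|w [f _ []]//].
  by exists (Y w) => //=; rewrite mem_index_enum.
rewrite {1}EU measure_fin_bigcup//; last by move=> f _; exact: measurableI.
  by rewrite -fsbig_seq ?index_enum_uniq.
by move=> f g _ _ [w [[_ /= <-] [_ /= <-]]].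
Qed.

(** Cancelling the diagonal entry 1 from the row sum 1 leaves nonnegative entries with sum 0. *)
Lemma absorbing_row0 {R : realType} {k : nat} {A : 'M[R]_k.+1}
    {i j : 'I_k.+1} :
  stochastic_mx A -> absorbing A i -> j != i -> A i j = 0.
Proof.
move=> [A0 A1] Aii ji; have := A1 i.
rewrite (bigD1 i)//= Aii -[X in _ = X]addr0 => /addrI.
by move/psumr_eq0P => ->.
Qed.

Section MarkovChain.
Context {R : realType} {k : nat} {d : measure_display} {T : measurableType d}.
Context {Pr : probability T R} {X : nat -> {RV Pr >-> 'I_k.+1}}.
Implicit Types (i j : 'I_k.+1) (n : nat) (Q : set 'I_k.+1).

Lemma measurable_state n Q : measurable [set w | Q (X n w)].
Proof.
by rewrite -[X in measurable X]/(X n @^-1` Q); exact: measurable_funPTI.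
Qed.

Lemma measurable_past n (Q : nat -> set 'I_k.+1) :
  measurable [set w | forall m, (m <= n)%N -> Q m (X m w)].
Proof.
have -> : [set w | forall m, (m <= n)%N -> Q m (X m w)] =
    \bigcap_(m in [set m | (m <= n)%N]) [set w | Q m (X m w)] by [].
by apply: bigcap_measurable => [|m _]; [exists 0%N | exact: measurable_state].
Qed.

Lemma prob_setI_neq_null {B : set T} {n : nat} {i} : measurable B ->
  (forall j, j != i -> Pr (B `&` [set w | X n w = j]) = 0%E) ->
  Pr (B `&` [set w | X n w != i]) = 0%E.
Proof.
move=> mB Bj.
have mBi : measurable (B `&` [set w | X n w != i]).
  by apply: measurableI => //; exact: (measurable_state n [set j | j != i]).
rewrite (prob_partition_fintype Pr (X n) mBi); last first.
  by move=> j; exact: (measurable_state n [set j]).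
apply: big1 => j _; have [->|ji] := eqVneq j i.
  rewrite (_ : _ `&` _ = set0) ?measure0//.
  by apply/seteqP; split => // w [[_ /= /eqP]].
apply: (subset_measure0 _ _ _ (Bj j ji)).
- by apply: measurableI => //; exact: (measurable_state n [set j]).
- by apply: measurableI => //; exact: (measurable_state n [set j]).
- by move=> w [[]].
Qed.

Context {A : 'M[R]_k.+1}.
Hypothesis hX : markov_chain X A.

(** Product form of the Markov property. It also covers a null past, where both sides vanish, so
    later arguments need no conditioning. *)
Lemma markov_path n (x : nat -> 'I_k.+1) j :
  (Pr ([set w | forall m, (m <= n)%N -> X m w = x m] `&` [set w | X n.+1 w = j])
   = Pr [set w | forall m, (m <= n)%N -> X m w = x m] * (A (x n) j)%:E)%E.
Proof.
set B := [set w | _].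
have mB : measurable B := measurable_past n (fun m => [set x m]).
have mBj : measurable (B `&` [set w | X n.+1 w = j]).
  by apply: measurableI => //; exact: (measurable_state _ [set j]).
have [B0|B0] := eqVneq (Pr B) 0%E.
  by rewrite B0 mul0e; apply: (subset_measure0 mBj mB) B0; exact: subIsetl.
have := hX n x j B0; rewrite /cond_prob setIC => <-.
rewrite -[Pr B in RHS]fineK ?fin_num_measure// -EFinM.
rewrite mulrC divfK ?fineK ?fin_num_measure//.
by rewrite fine_eq0 ?fin_num_measure.
Qed.

(** The hypothesis conditions on full trajectories only. Both sides are split over the finitely many
    trajectories up to time [n], and each one ending in [i] contributes the same factor [A i j]. *)
Lemma markov_step n i j :
  (Pr ([set w | X n w = i] `&` [set w | X n.+1 w = j]) =
   Pr [set w | X n w = i] * (A i j)%:E)%E.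
Proof.
pose Y w : {ffun 'I_n.+1 -> 'I_k.+1} := [ffun m : 'I_n.+1 => X m w].
(* [inord] extends a finite trajectory to all times; only the values at times up to [n] are ever
   read. *)
pose x (f : {ffun 'I_n.+1 -> 'I_k.+1}) (m : nat) := f (inord m).
have YE f : [set w | Y w = f] =
    [set w | forall m, (m <= n)%N -> X m w = x f m].
  apply/seteqP; split => w /= => [<- m mn|wf]; first by rewrite /x ffunE inordK.
  by apply/ffunP => m; rewrite ffunE wf ?/x ?inord_val// -ltnS.
have mY f : measurable [set w | Y w = f].
  by rewrite YE; exact: (measurable_past n (fun m => [set x f m])).
have mi : measurable [set w | X n w = i] := measurable_state n [set i].
have mj : measurable [set w | X n.+1 w = j] := measurable_state n.+1 [set j].
have niE f : x f n != i -> [set w | X n w = i] `&` [set w | Y w = f] = set0.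
  move=> fi; apply/seteqP; split => // w; rewrite YE => -[/= wi wf].
  by move: fi; rewrite -(wf n)// wi eqxx.
have iE f : x f n = i ->
    [set w | X n w = i] `&` [set w | Y w = f] = [set w | Y w = f].
  by move=> <-; apply: setIidr => w; rewrite YE; exact.
rewrite (prob_partition_fintype Pr Y (measurableI _ _ mi mj))//.
rewrite (prob_partition_fintype Pr Y mi)//.
rewrite ge0_sume_distrl//; apply: eq_bigr => f _; rewrite setIAC.
have [fi|fi] := eqVneq (x f n) i; last by rewrite niE// set0I measure0 mul0e.
by rewrite iE// YE markov_path fi.
Qed.

(** Induction on [n]: conditioning on the state at time [n] reproduces the matrix product of
    [A ^+ n] with [A]. *)
Lemma markov_marginal n j : Pr [set w | X 0%N w = ord0] = 1%E ->
  Pr [set w | X n w = j] = ((A ^+ n) ord0 j)%:E.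
Proof.
move=> X0; elim: n j => [|n IH] j.
  rewrite expr0 mxE; have [<-//|j0] := eqVneq ord0 j.
  (* The chain starts at 0 only almost surely, so the other initial states give null events, not
     necessarily empty ones. *)
  apply: (subset_measure0 (measurable_state 0 [set j])
    (measurable_state 0 [set i | i <> ord0])).
    by move=> w /= ->; apply/eqP; rewrite eq_sym.
  suff : Pr (~` [set w | X 0%N w = ord0]) = 0%E by [].
  rewrite probability_setC ?X0 ?subee//.
  exact: (measurable_state 0 [set ord0]).
rewrite (prob_partition_fintype Pr (X n) (measurable_state n.+1 [set j]));
  last by move=> i; exact: (measurable_state n [set i]).
rewrite exprSr [in RHS]mxE -sumEFin; apply: eq_bigr => i _.
by rewrite setIC EFinM -IH markov_step.
Qed.

Hypotheses (hA : stochastic_mx A) (habs : absorbing A ord_max).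

Lemma prob_leave_absorbing n :
  Pr ([set w | X n w = ord_max] `&` [set w | X n.+1 w != ord_max]) = 0%E.
Proof.
apply: prob_setI_neq_null (measurable_state n [set ord_max]) _ => j jmax.
by rewrite markov_step (absorbing_row0 hA habs jmax) mule0.
Qed.

(** The two events differ by the trajectories that visit [ord_max] and have left it by time [n],
    which form a null set. *)
Lemma prob_avoid_absorbing n :
  Pr [set w | forall m, (m <= n)%N -> X m w != ord_max] =
  Pr [set w | X n w != ord_max].
Proof.
pose S n := [set w | forall m, (m <= n)%N -> X m w != ord_max].
pose H n := [set w | X n w != ord_max].
have mS m : measurable (S m).
  exact: (measurable_past m (fun=> [set i | i != ord_max])).
have mH m : measurable (H m) := measurable_state m [set i | i != ord_max].
(* A trajectory off [ord_max] at time [n.+1] after an earlier visit either was already off it at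
   time [n] after such a visit, which is the induction hypothesis, or leaves it exactly at step [n],
   which is the null event [L]. *)
have HS0 : Pr (H n `\` S n) = 0%E.
  elim: n => [|n IH].
    rewrite (_ : _ `\` _ = set0) ?measure0//.
    by apply/seteqP; split => // w [Hw]; apply => m; rewrite leqn0 => /eqP ->.
  pose L := [set w | X n w = ord_max] `&` H n.+1.
  have mL : measurable L.
    by apply: measurableI => //; exact: (measurable_state n [set ord_max]).
  apply: (@subset_measure0 _ _ _ Pr _ ((H n `\` S n) `|` L)).
  - exact: measurableD.
  - by apply: measurableU => //; exact: measurableD.
  - move=> w [Hw nSw]; have [wn|wn] := eqVneq (X n w) ord_max; first by right.
    left; split => // Sw; apply: nSw => m; rewrite leq_eqVlt => /predU1P[->//|].
    by rewrite ltnS; exact: Sw.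
  - suff : Pr ((H n `\` S n) `|` L) = 0%E by [].
    rewrite measureU0//; first exact: measurableD.
    exact: prob_leave_absorbing.
rewrite -/(S n) -/(H n) -[in RHS](setDUK (_ : S n `<=` H n)); last first.
  by move=> w; apply.
by rewrite measureU0//; exact: measurableD.
Qed.

(** Hitting times are natural numbers or [+oo], so exceeding [t] amounts to exceeding its integer
    part. For negative [t], [Num.trunc t] would be 0, a wrong cutoff. *)
Lemma hitting_time_gt t : 0 <= t ->
  [set w | (t%:E < hitting_time R X k w)%E] =
  [set w | forall m, (m <= Num.trunc t)%N -> X m w != ord_max].
Proof.
move=> t0; apply/seteqP; split => w /= => [tw m|wt].
  rewrite truncn_ge_nat// => mt; apply/eqP => wm.
  move: tw; rewrite ltNge => /negP; apply.
  apply: (@le_trans _ _ m%:R%:E); last by rewrite lee_fin.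
  by apply: ereal_inf_lbound; exists m => //=; rewrite wm.
(* A strict bound need not survive an infimum, so a fixed number above [t] is inserted that bounds
   every hitting index from below. *)
apply: (@lt_le_trans _ _ (Num.trunc t).+1%:R%:E).
  by rewrite lte_fin truncnS_gt.
apply: le_ereal_inf_tmp => _ [m /= km <-]; rewrite lee_fin ler_nat.
rewrite ltnNge; apply/negP => /wt/eqP; apply; apply/val_inj => /=.
by apply/eqP; rewrite eqn_leq km -ltnS ltn_ord.
Qed.

Lemma prob_hitting_time_gt t : Pr [set w | X 0%N w = ord0] = 1%E -> 0 <= t ->
  Pr [set w | (t%:E < hitting_time R X k w)%E] =
  (1 - (A ^+ Num.trunc t) ord0 ord_max)%:E.
Proof.
move=> X0 t0; rewrite hitting_time_gt// prob_avoid_absorbing.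
have -> : [set w | X (Num.trunc t) w != ord_max] =
    ~` [set w | X (Num.trunc t) w = ord_max].
  by apply/seteqP; split => w /= /eqP.
rewrite (probability_setC Pr (measurable_state (Num.trunc t) [set ord_max])).
by rewrite (markov_marginal _ _ X0).
Qed.

End MarkovChain.

Lemma unlhd_mx_ord_max {R : realType} {k : nat} (A' A : 'M[R]_k.+1)
    (i : 'I_k.+1) :
  unlhd_mx A' A -> A' i ord_max <= A i ord_max.
Proof.
(* At the top index, each tail sum has a single term. *)
move=> /(_ i i (leqnn _) ord_max); rewrite !(big_pred1 ord_max) ?mxE// => l /=;
by rewrite -val_eqE/= eqn_leq -[(l <= k)%N]ltnS ltn_ord.
Qed.

Theorem theorem4 (R : realType) (k : nat) (hk : (1 <= k)%N)
    (P Pt : 'M[R]_k.+1)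
    (hP : stochastic_mx P) (hPt : stochastic_mx Pt)
    (d : measure_display) (T : measurableType d) (Pr : probability T R)
    (X : nat -> {RV Pr >-> 'I_k.+1})
    (d' : measure_display) (T' : measurableType d') (Pr' : probability T' R)
    (Xt : nat -> {RV Pr' >-> 'I_k.+1})
    (hX : markov_chain X P) (hXt : markov_chain Xt Pt)
    (hX0 : Pr [set w | X 0%N w = ord0] = 1%E)
    (hXt0 : Pr' [set w | Xt 0%N w = ord0] = 1%E)
    (habs : absorbing P ord_max) (habst : absorbing Pt ord_max)
    (hpow : \forall n \near \oo, unlhd_mx (Pt ^+ n) (P ^+ n)) :
  le_ast Pr Pr' (hitting_time R X k) (hitting_time R Xt k).
Proof.
(* The rank [N] serves as threshold: [N <= t] forces [N <= Num.trunc t], so the order holds for the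
   very power that gives both tails at [t]. *)
case: hpow => N _ hN; exists N%:R => t Nt.
have t0 : 0 <= t by exact: le_trans Nt.
rewrite (prob_hitting_time_gt hX)// (prob_hitting_time_gt hXt)//.
rewrite lee_fin lerD2l lerN2; apply: unlhd_mx_ord_max; apply: hN => /=.
by rewrite truncn_ge_nat.
Qed.
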